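(* Let $X_1,X_2,X_3,\dots$ be second countable, locally compact metric spaces, and let $$W_0=\{0\}\cup\bigcup_{k=1}^{\infty}(X_1\times\cdots\times X_k)\cup\prod_{n=1}^{\infty}X_n$$ with the quotient topology determined by the map $Q:\prod_{n=1}^\infty X_n^\infty\to W_0$. Let $\{x^n\}$ be a sequence in $W_0$ and $x\in W_0$. Then $x^n\to x$ in $W_0$ if and only if $x^n\to x$ pointwise.
   Context: The unions are disjoint unions and $0$ is an extra point (the ''empty sequence''). For each $n$, $X_n^\infty=X_n\cup\{\infty_n\}$ is the one-point compactification of $X_n$ (a point $\infty_n$ is always adjoined; it is isolated if $X_n$ is already compact). $A=\prod_{n=1}^\infty X_n^\infty$ has the product topology. The surjection $Q:A\to W_0$ is defined by: $Q(\{x_i\})=\{x_i\}$ if $x_i\neq\infty_i$ for all $i$; $Q(\{x_i\})=(x_1,\dots,x_n)$ if $x_1\ne\infty_1$ and $n\ge1$ is the smallest integer with $x_{n+1}=\infty_{n+1}$; $Q(\{x_i\})=0$ if $x_1=\infty_1$. $W_0$ is given the quotient topology: $U\subset W_0$ is open iff $Q^{-1}(U)$ is open in $A$. Write $Z=\prod_{n=1}^\infty X_n$ and $Y_0=\{0\}\cup\bigcup_{k\ge1}(X_1\times\cdots\times X_k)$. The length $\ell(w)\in\{0,1,2,\dots\}\cup\{\infty\}$ of $w\in W_0$ is $\infty$ if $w\in Z$, $k$ if $w\in X_1\times\cdots\times X_k$, and $0$ if $w=0$; $w_i$ denotes the $i$th component of $w$ for $i\le\ell(w)$ finite. Pointwise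 convergence: a sequence $x^n=\{x^n_i\}$ in $W_0$ converges to $x\in W_0$ pointwise if (i) in case $x\in Z$: $\ell(x^n)\to\infty$ and $x^n_i\to x_i$ for all $i$; (ii) in case $x\in Y_0$: $\ell(x^n)\ge\ell(x)$ eventually, $x^n_i\to x_i$ for $1\le i\le\ell(x)$, and $x^n_{\ell(x)+1}\to\infty_{\ell(x)+1}$ in $X^\infty_{\ell(x)+1}$, where $x^n_{\ell(x)+1}$ is taken to be $\infty_{\ell(x)+1}$ if $\ell(x^n)=\ell(x)$. (The component $x^n_i$ need only be defined for all sufficiently large $n$, which the length conditions guarantee.) *)

(* Defs.v *)
From HB Require Import structures.
From mathcomp Require Import all_boot all_order all_algebra.
From mathcomp Require Import all_classical all_reals topology.

Set Implicit Arguments.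
Unset Strict Implicit.
Unset Printing Implicit Defensive.

Local Open Scope classical_set_scope.

(* Indices start at 0: [X i] is the factor X_(i+1), and the component w_(i+1)
   of a sequence w is read at index i. A sequence of length k has its indices
   in 'I_k; the extra point 0 is the unique sequence of length 0. *)
Inductive W0 (X : nat -> Type) : Type :=
| FinSeq k (w : forall i : 'I_k, X i)
| InfSeq (z : forall i, X i).
Arguments FinSeq {X k} w.
Arguments InfSeq {X} z.

Section Sequences.
Context {X : nat -> Type}.

(* [None] stands for an infinite length. *)
Definition length (w : W0 X) : option nat :=
  match w with FinSeq k _ => Some k | InfSeq _ => None end.

Definition length_ge (k : nat) (w : W0 X) : bool :=
  if length w is Some m then k <= m else true.

(* The point at infinity [None] beyond the length of the sequence. *)
Definition component (w : W0 X) (i : nat) : one_point_compactification (X i) :=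
  match w with
  | @FinSeq _ k w =>
      match @idP (i < k) with
      | ReflectT lt_ik => Some (w (Ordinal lt_ik))
      | ReflectF _ => None
      end
  | InfSeq z => Some (z i)
  end.

Definition unsome T (o : option T) : isSome o -> T :=
  match o with
  | Some t => fun=> t
  | None => fun no => False_rect T (notF no)
  end.

Lemma unsomeK T (o : option T) (so : isSome o) : Some (unsome so) = o.
Proof. by case: o so. Qed.

Variable x : forall n, one_point_compactification (X n).

Lemma isSome_before_min (ex : exists n, ~~ isSome (x n)) (i : 'I_(ex_minn ex)) :
  isSome (x i).
Proof.
case: i => i /=; case: ex_minnP => m _ min_m lt_im.
by apply: contraLR lt_im => xi; rewrite -leqNgt min_m.
Qed.

Lemma isSome_never (nex : ~ exists n, ~~ isSome (x n)) n : isSome (x n).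
Proof. by apply/negPn/negP => xn; apply: nex; exists n. Qed.

Definition Q : W0 X :=
  match pselect (exists n, ~~ isSome (x n)) with
  | left ex => FinSeq (fun i : 'I_(ex_minn ex) => unsome (isSome_before_min i))
  | right nex => InfSeq (fun n => unsome (isSome_never nex n))
  end.

End Sequences.

Lemma component_fin (X : nat -> Type) k (w : forall i : 'I_k, X i) (i : 'I_k) :
  component (FinSeq w) i = Some (w i).
Proof.
case: i => i lt_i; rewrite /component /=.
by case: {-}_ / idP => [lt_ik|//]; rewrite (bool_irrelevance lt_ik lt_i).
Qed.

Lemma component_out (X : nat -> Type) k (w : forall i : 'I_k, X i) i :
  k <= i -> component (FinSeq w) i = None.
Proof.
by rewrite /component leqNgt => /negP; case: {-}_ / idP.
Qed.

Lemma eq_FinSeq (X : nat -> Type) m k (u : forall i : 'I_m, X i)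
    (w : forall i : 'I_k, X i) : m = k ->
  (forall i : 'I_m, Some (u i) = component (FinSeq w) i) -> FinSeq u = FinSeq w.
Proof.
move=> mk; case: k / mk w => w uw; congr FinSeq.
apply: functional_extensionality_dep => i.
by apply: Some_inj; rewrite uw component_fin.
Qed.

Lemma componentK (X : nat -> Type) : cancel (@component X) (@Q X).
Proof.
case=> [k w|z]; rewrite /Q; case: pselect => [ex|nex].
- apply: eq_FinSeq => [|i]; last by rewrite unsomeK.
  case: ex_minnP => m Nm min_m; apply/eqP; rewrite eqn_leq.
  rewrite min_m ?component_out//= leqNgt; apply: contra Nm => lt_mk.
  by rewrite (component_fin w (Ordinal lt_mk)).
- by case: nex; exists k; rewrite component_out.
- by case: (ex) => n.
- by [].
Qed.

Section Topology.
Variable X : nat -> topologicalType.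

Definition A : topologicalType :=
  prod_topology (fun n => one_point_compactification (X n) : topologicalType).

(* This makes [Q] the projection \pi of [W0] seen as a quotient of [A]. *)
HB.instance Definition _ :=
  @isQuotient.Build A (W0 X) (@component X) (@Q X) (@componentK X).
HB.instance Definition _ :=
  Topological.copy (W0 X) (quotient_topology (W0 X : quotType A)).

Lemma open_W0 (U : set (W0 X)) :
  open U <-> open (@Q X @^-1` U : set A).
Proof.
have -> : @Q X = (\pi_(quotient_topology (W0 X : quotType A)))%qT.
  by apply: funext => a; rewrite unlock.
by [].
Qed.

End Topology.

(* Components need only be defined eventually, so that a partial sequence
   converges when it eventually agrees with a convergent sequence. *)
Definition partial_cvg (T : topologicalType) (u : nat -> option T) (l : T) :=
  exists2 v : nat -> T,
    (\forall n \near \oo, u n = Some (v n)) & v n @[n --> \oo] --> l.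

Definition pointwise_cvg (X : nat -> topologicalType)
    (x : nat -> W0 X) (l : W0 X) : Prop :=
  match l with
  | InfSeq z =>
      (forall N, \forall n \near \oo, length_ge N (x n)) /\
      (forall i, partial_cvg (fun n => component (x n) i) (z i))
  | @FinSeq _ k w =>
      [/\ \forall n \near \oo, length_ge k (x n),
          forall i : 'I_k, partial_cvg (fun n => component (x n) i) (w i) &
          component (x n) k @[n --> \oo] -->
            (None : one_point_compactification (X k))]
  end.

(* Main.v *)
Require Import Defs.
From mathcomp Require Import all_boot all_order all_algebra.
From mathcomp Require Import all_classical all_reals topology.

Set Implicit Arguments.
Unset Strict Implicit.
Unset Printing Implicit Defensive.

Local Open Scope classical_set_scope.

(** Pointwise convergence to [l] amounts to the convergence of the [i]th
    components for all indices [i] up to and including the length of [l].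
    These components are continuous at [l]: the sequences with at least [i]
    components and with [i]th component in a given open set form a set whose
    preimage under [Q] is open. Conversely, if the sequence stays out of an open
    neighbourhood [U] of [l] frequently, the corresponding points of the compact
    space [A] have a cluster point [a] outside the preimage of [U]; since the
    one-point compactifications are Hausdorff, [a] agrees with [l] up to the
    length of [l], so that [Q a = l], a contradiction. *)

Lemma isSome_component (X : nat -> Type) (w : W0 X) i :
  isSome (component w i) = length_ge i.+1 w.
Proof.
case: w => [k w|//]; rewrite [RHS]/=; case lt_ik: (i < k); last first.
  by rewrite component_out// leqNgt lt_ik.
by rewrite (component_fin w (Ordinal lt_ik)).
Qed.

Lemma length_ge_leq (X : nat -> Type) (w : W0 X) i j :
  j <= i -> length_ge i w -> length_ge j w.
Proof. by case: w => //= k w; exact: leq_trans. Qed.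

Lemma length_ge0 (X : nat -> Type) (w : W0 X) : length_ge 0 w.
Proof. by case: w. Qed.

Section projection.
Variable X : nat -> Type.
Implicit Types a b : forall n, one_point_compactification (X n).

(** [Q] cuts [a] at its first point at infinity and [component] pads with [None], so the equality
    still holds when [i] is itself the index of that point. *)
Lemma component_Q a i :
  (forall j, j < i -> isSome (a j)) -> component (Q a) i = a i.
Proof.
move=> a_lt; rewrite /Q; case: pselect => [ex|nex]; last exact: unsomeK.
have [lt_i|ge_i] := ltnP i (ex_minn ex).
  by rewrite (component_fin _ (Ordinal lt_i)) unsomeK.
rewrite component_out//; move: ge_i; case: ex_minnP => m Nam _.
rewrite leq_eqVlt => /predU1P[<-|/a_lt]; last by rewrite (negbTE Nam).
by case: (a m) Nam.
Qed.

Lemma length_ge_Q a i :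
  length_ge i (Q a) <-> forall j, j < i -> isSome (a j).
Proof.
split=> [Qa_i|]; last first.
  case: i => [_|i a_lt]; first exact: length_ge0.
  by rewrite -isSome_component component_Q ?a_lt// => j /ltnW; exact: a_lt.
elim/ltn_ind => j IHj lt_ji.
rewrite -component_Q => [|m lt_mj]; last exact/IHj/(ltn_trans lt_mj).
by rewrite isSome_component (length_ge_leq lt_ji).
Qed.

(** [Q a] depends only on the entries of [a] up to and including its first point at infinity. *)
Lemma eq_Q a b :
  (forall i, (forall j, j < i -> isSome (a j)) -> a i = b i) -> Q a = Q b.
Proof.
move=> ab; apply: (can_inj (@componentK X)).
apply/functional_extensionality_dep; elim/ltn_ind => i IH.
have [a_lt|] := pselect (forall j, j < i -> isSome (a j)).
  rewrite !component_Q ?ab// => j lt_ji; rewrite -ab ?a_lt// => m lt_mj.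
  by rewrite a_lt// (ltn_trans lt_mj).
move=> Na.
(* By induction [Q b] also has [None] at such a [j], and a sequence that has ended at [j] has [None]
   at every later index. *)
suff [j lt_ji Nj] : exists2 j, j < i & component (Q a) j = None.
  have None_i c : component (Q c) j = None -> component (Q c) i = None.
    move=> cj; have := @length_ge_leq _ (Q c) i.+1 j.+1 (leqW lt_ji).
    rewrite -!isSome_component cj.
    by case: component => // ? /(_ isT).
  by rewrite !None_i// -IH.
apply: contra_notP Na => Nj; apply/length_ge_Q.
case: i Nj {IH} => [_|i Nj]; first exact: length_ge0.
by rewrite -isSome_component; case E : component => //; case: Nj; exists i.
Qed.

End projection.

Section one_point_compactification.
Variable T : topologicalType.

Lemma open_isSome : open [set o : one_point_compactification T | isSome o].
Proof.
rewrite (_ : [set o | _] = Some @` [set: T]).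
  exact/one_point_compactification_open_some/openT.
by apply/seteqP; split => [[t|]//= _|o [t _ <-]//]; exists t.
Qed.

Lemma cvg_Some_near (I : Type) (F : set_system I)
    (u : I -> one_point_compactification T) (t : T) :
  u n @[n --> F] --> (Some t : one_point_compactification T) ->
  \forall n \near F, isSome (u n).
Proof.
move=> ut; apply: (ut [set o | isSome o]); apply: open_nbhs_nbhs.
by split=> //; exact: open_isSome.
Qed.

(** [Some] embeds [T] as an open subspace, so convergence to [Some t] forces [u n] into its image
    eventually. *)
Lemma partial_cvgP (u : nat -> option T) (t : T) :
  partial_cvg u t <->
  u n @[n --> \oo] --> (Some t : one_point_compactification T).
Proof.
split=> [[v uv vt] V /vt Vv|ut].
  suff : \forall n \near \oo, V (u n) by [].
  by apply: filterS2 uv Vv => n ->.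
(* The default [t] is used for finitely many [n] only. *)
exists (fun n => odflt t (u n)).
  by apply: filterS (cvg_Some_near ut) => n; case: (u n).
move=> V /one_point_compactification_some_nbhs/ut.
rewrite -[X in X -> _]/(\forall n \near \oo, (Some @` V) (u n)) => uV.
suff : \forall n \near \oo, V (odflt t (u n)) by [].
by apply: filterS uV => n [s Vs /= <-].
Qed.

(** A closed compact neighbourhood of [t] and its complement with infinity added separate [t] from
    infinity. *)
Lemma one_point_compactification_hausdorff :
  hausdorff_space T -> locally_compact [set: T] ->
  hausdorff_space (one_point_compactification T).
Proof.
move=> hT lT.
have sep (t : T) : exists U V,
    [/\ nbhs (Some t : one_point_compactification T) U,
        nbhs (None : one_point_compactification T) V & U `&` V = set0].
  have [K + [cK clK]] := lT t I; rewrite withinET => Kt.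
  exists (Some @` K), (Some @` (~` K) `|` [set None]); split.
  - exact: one_point_compactification_some_nbhs.
  - by exists K.
  - by rewrite -subset0 => _ [[k Kk <-] [[k' + [kk']]|//]]; rewrite kk'.
move=> [p|] [q|] // pq.
- congr Some; apply: hT => U V /one_point_compactification_some_nbhs pU
    /one_point_compactification_some_nbhs qV.
  have [_ [[t Ut <-] [t' Vt' [tt']]]] := pq _ _ pU qV.
  by exists t; split => //; rewrite -tt'.
- have [U [V [pU qV UV]]] := sep p.
  by have := pq _ _ pU qV; rewrite UV => -[].
- have [U [V [qU pV UV]]] := sep q.
  by have := pq _ _ pV qU; rewrite setIC UV => -[].
Qed.

End one_point_compactification.

Lemma open_forall_ltn (T : topologicalType) (U : nat -> set T) i :
  (forall j, open (U j)) -> open [set t | forall j, j < i -> U j t].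
Proof.
move=> oU; elim: i => [|i IHi].
  by rewrite (_ : [set _ | _] = setT) -?subTset//; exact: openT.
rewrite (_ : [set _ | _] = [set t | forall j, j < i -> U j t] `&` U i).
  exact: openI.
apply/seteqP; split => [t Ut|t [Ut Uit] j].
  by split=> [j ?|]; apply/Ut => //; exact: ltnW.
by rewrite ltnS leq_eqVlt => /predU1P[->|/Ut].
Qed.

Lemma cluster_fmap (S T : topologicalType) (f : S -> T) (F : set_system S)
    (p : S) :
  {for p, continuous f} -> cluster F p -> cluster (f @ F) (f p).
Proof.
move=> fp Fp U V FU pV.
by have [s [Us Vs]] := Fp _ _ FU (fp _ pV); exists (f s).
Qed.

Section convergence.
Variable X : nat -> topologicalType.

(* When [l] has length [i], a set of sequences defined by a condition on the
   [i]th component alone need not be a neighbourhood of [l]; adding that the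
   length is at least [i] makes it saturated and open. *)
Lemma cvg_component (l : W0 X) i :
  length_ge i l -> component u i @[u --> l] --> component l i.
Proof.
move=> l_i V; rewrite nbhsE => -[O [oO Ol] OV].
pose U := [set w : W0 X | length_ge i w /\ O (component w i)].
apply: (@filterS _ (nbhs l) _ U) => [w [_ /OV]//|].
apply: open_nbhs_nbhs; split => //; apply/open_W0.
pose U' : set (A X) :=
  [set a | forall j, j < i -> isSome (a j)] `&` (fun a => a i) @^-1` O.
rewrite (_ : _ @^-1` _ = U').
  apply: openI.
    apply: (@open_forall_ltn _ (fun j (a : A X) => isSome (a j))) => j.
    apply: (@open_comp _ _ (fun a : A X => a j) [set o | isSome o]).
      by move=> a _; exact: proj_continuous.
    exact: open_isSome.
  by apply: (@open_comp _ _ (fun a : A X => a i)) => // a _;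
    exact: proj_continuous.
by apply/seteqP; split=> a; rewrite /U/= length_ge_Q => -[a_lt];
  rewrite component_Q.
Qed.

Hypothesis hausdorffX : forall i, hausdorff_space (X i).
Hypothesis locally_compactX : forall i, locally_compact [set: X i].

Lemma compact_A : compact [set: A X].
Proof.
have := @tychonoff _ (fun i => one_point_compactification (X i)) _
  (fun i => @one_point_compactification_compact (X i)).
by rewrite (_ : [set f | _] = setT) // -subTset.
Qed.

Lemma cvg_W0P (I : Type) (F : set_system I) (x : I -> W0 X) (l : W0 X) :
  Filter F ->
  (x n @[n --> F] --> l) <->
  (forall i, length_ge i l -> component (x n) i @[n --> F] --> component l i).
Proof.
move=> FF; split => [xl i l_i V /(cvg_component l_i)/xl//|xl].
move=> P; rewrite nbhsE => -[U [oU Ul] UP].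
suff FU : F (x @^-1` U).
  exact: (filterS (P := x @^-1` U) (fun n => UP (x n)) FU).
apply: contrapT => nFU.
(* The trace of [F] on the indices where [x] avoids [U] is proper precisely because [x] is not in
   [U] eventually. *)
pose G := within (x @^-1` ~` U) F.
have PG : ProperFilter G.
  apply: Build_ProperFilter_ex => B GB; apply: contrapT => /forallNP NB.
  apply: nFU; apply: (@filterS _ F _ _ _ _ GB) => n BP.
  by apply: contrapT => /BP; exact: NB.
(* [component] is a section of [Q], so [y] lifts [x] to the compact space [A X]. *)
pose y n : A X := component (x n).
have [a [_ Ga]] := compact_A (F := y @ G) _ filterT.
have Qa : Q a = l.
  apply/esym; rewrite -[l in LHS]componentK; apply: eq_Q => i.
  move/length_ge_Q; rewrite componentK => l_i.
  (* The entry [a i] is a cluster point of the components at [i], which converge along the finer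
     filter [G] too; in a Hausdorff space it must be their limit. *)
  apply: one_point_compactification_hausdorff => //.
  have /cluster_fmap /(_ Ga) :=
    @proj_continuous _ (fun j => one_point_compactification (X j)) i a.
  apply: cvg_cluster.
  exact: (cvg_within_filter (f := fun n => component (x n) i) _ (xl i l_i)).
have aU : nbhs a (@Q X @^-1` U).
  by apply: open_nbhs_nbhs; split; [exact/open_W0|rewrite /preimage/= Qa].
have GU : (y @ G) (@Q X @^-1` ~` U).
  by apply: (@filterS _ F _ _ _ _ filterT) => n _ /= nUx; rewrite componentK.
by have [b []] := Ga _ _ GU aU.
Qed.

End convergence.

Theorem theorem3p6 (R : realType) (X : nat -> metricType R)
    (X_second_countable : forall i, @second_countable (X i))
    (X_locally_compact : forall i, locally_compact [set: X i])
    (x : nat -> W0 X) (l : W0 X) :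
  (x n @[n --> \oo] --> l) <-> pointwise_cvg x l.
Proof.
have length_near i (t : X i) : component (x n) i @[n --> \oo] -->
      (Some t : one_point_compactification (X i)) ->
    \forall n \near \oo, length_ge i.+1 (x n).
  by under eq_near do rewrite -isSome_component; exact: cvg_Some_near.
rewrite cvg_W0P//; last by move=> i; exact: metric_hausdorff.
case: l => [k w|z]; split.
- move=> xw; have xw_lt (i : 'I_k) : component (x n) i @[n --> \oo] -->
      (Some (w i) : one_point_compactification (X i)).
    by have := xw i (ltnW (ltn_ord i)); rewrite component_fin.
  split; last by have := xw k (leqnn k); rewrite component_out.
    (* For positive length, convergence of the last component to a finite point bounds the lengths
       from below. *)
    case: k w xw xw_lt => [|k] w _ xw_lt.
      by near=> n; exact: length_ge0.
    exact: length_near (xw_lt ord_max).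
  by move=> i; exact/partial_cvgP/xw_lt.
- move=> [_ xw_lt xw_k] i; rewrite -[length_ge _ _]/(i <= k) leq_eqVlt.
  case/predU1P => [->|lt_ik]; first by rewrite component_out.
  rewrite (component_fin w (Ordinal lt_ik)).
  exact/partial_cvgP/(xw_lt (Ordinal _)).
- move=> xz; split => [[|i]|i]; last by apply/partial_cvgP; exact: xz.
    by near=> n; exact: length_ge0.
  exact: length_near (xz i isT).
- by move=> [_ xz] i _; exact/partial_cvgP/xz.
Unshelve. all: by end_near. Qed.
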